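(* For every Parry number $\beta$, the number of irreducible factors of the Parry polynomial $n_\beta^*(X)$ in $\mathbb{Z}[X]$ which are non-cyclotomic and non-reciprocal, counted with multiplicities, is strictly less than $$\frac{\log\|n_\beta^*\|_2}{\log\theta_0},$$ where $\theta_0=1.3247\ldots$ is the dominant root of $X^3-X-1$. (This count includes the minimal polynomial $P_\beta$ of $\beta$ when $P_\beta$ is non-reciprocal.)
   Context: For non-integer $\beta>1$, let $d_\beta(1)=0.t_1t_2\ldots$ with $t_1=\lfloor\beta\rfloor$, $t_{j+1}=\lfloor\beta T_\beta^j(1)\rfloor$, $T_\beta(x)=\beta x-\lfloor\beta x\rfloor$; $\beta$ is a Parry number if $(t_i)$ is eventually periodic. Parry polynomial: if $t_i=0$ for $i>m$, $t_m\neq0$: $n_\beta^*(X)=X^m-\sum_{i=1}^mt_iX^{m-i}$; otherwise with minimal preperiod $m\ge0$ and period $p+1$: if $m\ge1$, $n_\beta^*(X)=X^{m+p+1}-\sum_{i=1}^{m+p+1}t_iX^{m+p+1-i}-X^m+\sum_{i=1}^mt_iX^{m-i}$; if $m=0$, $n_\beta^*(X)=X^{p+1}-\sum_{i=1}^pt_iX^{p+1-i}-(1+t_{p+1})$. For a polynomial $R$ of degree $n$, $R^*(X)=X^nR(1/X)$; $R$ is reciprocal if $R=R^*$. $\|\cdot\|_2$ is the square root of the sum of squared moduli of the coefficients. *)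

(* Defs.v *)
From mathcomp Require Import all_boot all_order all_algebra all_field.
From mathcomp Require Import complex ring lra zify.
From mathcomp Require Import boolp reals exp.

Set Implicit Arguments.
Unset Strict Implicit.
Unset Printing Implicit Defensive.

Import Order.TTheory GRing.Theory Num.Theory.
Local Open Scope ring_scope.

Section BetaExpansion.
Variables (R : realType) (beta : R).

Definition beta_map (x : R) : R := beta * x - (Num.floor (beta * x))%:~R.

(* Meaningful for i >= 1 only; the value at i = 0 is never used. *)
Definition parry_digit (i : nat) : int :=
  Num.floor (beta * iter i.-1 beta_map 1).

Local Notation t := parry_digit.

(* Preperiod at most m, with q.+1 a (not necessarily minimal) period. *)
Definition digits_periodic_from (m q : nat) : Prop :=
  forall i, (m < i)%N -> t (i + q.+1) = t i.

Definition parry_number : Prop :=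
  [/\ 1 < beta, beta \isn't a Num.int & exists m q, digits_periodic_from m q].

Definition digits_end_at (m : nat) : Prop :=
  [/\ (0 < m)%N, t m != 0 & forall i, (m < i)%N -> t i = 0].

Definition minimal_preperiod_period (m p : nat) : Prop :=
  [/\ digits_periodic_from m p,
      forall m' q, digits_periodic_from m' q -> (m <= m')%N &
      forall q, digits_periodic_from m q -> (p <= q)%N].

(* In the two periodic cases m is the minimal preperiod and p.+1 the minimal
   period. *)
Variant is_parry_poly : {poly int} -> Prop :=
| ParryFinite m of digits_end_at m :
    is_parry_poly ('X^m - \sum_(1 <= i < m.+1) t i *: 'X^(m - i))
| ParryPreperiodic m p of
    ~ (exists k, digits_end_at k) & minimal_preperiod_period m p & (0 < m)%N :
    is_parry_poly
      ('X^(m + p.+1)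
       - \sum_(1 <= i < (m + p.+1).+1) t i *: 'X^(m + p.+1 - i)
       - 'X^m + \sum_(1 <= i < m.+1) t i *: 'X^(m - i))
| ParryPurelyPeriodic p of
    ~ (exists k, digits_end_at k) & minimal_preperiod_period 0 p :
    is_parry_poly
      ('X^(p.+1) - \sum_(1 <= i < p.+1) t i *: 'X^(p.+1 - i)
       - (1 + t p.+1)%:P).

Lemma ex_least (P : nat -> Prop) :
  (exists n, P n) -> exists n, P n /\ forall k, P k -> (n <= k)%N.
Proof.
move=> [n Pn]; have ex : exists n, `[< P n >] by exists n; apply/asboolP.
case: (ex_minnP ex) => k /asboolP Pk kmin; exists k; split=> // j /asboolP.
exact: kmin.
Qed.

Lemma is_parry_poly_exists : parry_number -> exists P, is_parry_poly P.
Proof.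
move=> [_ _ per]; have [[m mE]|nfin] := pselect (exists k, digits_end_at k).
  by eexists; apply: ParryFinite mE.
have [m [mper mmin]] := ex_least per.
have [p [pper pmin]] := ex_least mper.
have mp : minimal_preperiod_period m p.
  by split=> // m' q Hq; apply: mmin; exists q.
have [m0|m_gt0] := posnP m.
  by rewrite m0 in mp; eexists; apply: ParryPurelyPeriodic mp.
by eexists; apply: ParryPreperiodic mp m_gt0.
Qed.

Lemma digits_end_at_inj m m' : digits_end_at m -> digits_end_at m' -> m = m'.
Proof.
move=> [_ tm zm] [_ tm' zm']; case: (ltngtP m m') => // lt.
  by rewrite zm ?eqxx in tm'.
by rewrite zm' ?eqxx in tm.
Qed.

Lemma minimal_preperiod_period_inj m p m' p' :
  minimal_preperiod_period m p -> minimal_preperiod_period m' p' ->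
  m = m' /\ p = p'.
Proof.
move=> [Hm mmin pmin] [Hm' mmin' pmin'].
have e : m = m'.
  by apply/eqP; rewrite eqn_leq (mmin _ _ Hm') (mmin' _ _ Hm).
subst m'; split=> //.
by apply/eqP; rewrite eqn_leq (pmin _ Hm') (pmin' _ Hm).
Qed.

Lemma is_parry_poly_unique P Q : is_parry_poly P -> is_parry_poly Q -> P = Q.
Proof.
move=> [m Hm|m p nf Hm m0|p nf Hm] [m' Hm'|m' p' nf' Hm' m0'|p' nf' Hm'].
- by rewrite (digits_end_at_inj Hm Hm').
- by case: nf'; exists m.
- by case: nf'; exists m.
- by case: nf; exists m'.
- by have [-> ->] := minimal_preperiod_period_inj Hm Hm'.
- by have [e _] := minimal_preperiod_period_inj Hm Hm'; rewrite e in m0.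
- by case: nf; exists m'.
- by have [e _] := minimal_preperiod_period_inj Hm Hm'; rewrite -e in m0'.
- by have [_ ->] := minimal_preperiod_period_inj Hm Hm'.
Qed.

End BetaExpansion.

(* X^n p(1/X) with n = deg p: the coefficient of X^i is that of X^(n - i)
   in p. *)
Definition recip_poly (R : nzRingType) (p : {poly R}) : {poly R} :=
  \poly_(i < size p) p`_((size p).-1 - i).

Lemma horner_recip_poly (F : fieldType) (p : {poly F}) (x : F) :
  x != 0 -> (recip_poly p).[x] = x ^+ (size p).-1 * p.[x^-1].
Proof.
move=> x0; rewrite horner_poly horner_coef mulr_sumr.
rewrite (reindex_inj rev_ord_inj) /=; apply: eq_bigr => i _.
have lti : (i < size p)%N := ltn_ord i.
rewrite (_ : size p - i.+1 = (size p).-1 - i)%N; last first.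
  by case: (size p) (i : nat) => //= k j; rewrite subSS.
have lei : (i <= (size p).-1)%N by lia.
rewrite subKn // mulrCA exprVn; congr (_ * _).
by rewrite expfB_cond ?(negbTE x0).
Qed.

Definition reciprocal_poly (R : nzRingType) (p : {poly R}) : Prop :=
  p = recip_poly p.

Definition cyclotomic_poly (p : {poly int}) : Prop :=
  exists2 n, (0 < n)%N & p = 'Phi_n.

Definition irreducible_elt (D : idomainType) (x : D) : Prop :=
  [/\ x != 0, x \isn't a GRing.unit &
      forall a b, x = a * b -> a \is a GRing.unit \/ b \is a GRing.unit].

(* The list s, with repetitions, of the irreducible factors of a monic P in
   Z[X]; taking them monic fixes the signs. *)
Definition irreducible_factorization (P : {poly int}) (s : seq {poly int}) :
    Prop :=
  (forall f, f \in s -> f \is monic /\ irreducible_elt f) /\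
  P = \prod_(f <- s) f.

Definition noncyclo_nonrecip (f : {poly int}) : bool :=
  `[< ~ cyclotomic_poly f /\ ~ reciprocal_poly f >].

Lemma irreducible_factorization_exists (P : {poly int}) :
  P \is monic -> exists s, irreducible_factorization P s.
Proof.
have [n] := ubnP (size P); elim: n P => // n IHn P; rewrite ltnS => szP Pmon.
have [P1|P1] := eqVneq P 1.
  by exists [::]; split; rewrite ?big_nil.
have nU : P \isn't a GRing.unit.
  apply/negP; rewrite poly_unitE => /andP[/eqP s1 _].
  have P0 := eqP Pmon; rewrite lead_coefE s1 /= in P0.
  by move: P1; rewrite (size1_polyC (eq_leq s1)) P0 eqxx.
have [irr|nirr] := pselect (irreducible_elt P).
  exists [:: P]; split=> [f|]; last by rewrite big_seq1.
  by rewrite inE => /eqP ->.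
have [a [b [Pab [aU bU]]]] : exists a b : {poly int}, P = a * b /\
    (a \isn't a GRing.unit /\ b \isn't a GRing.unit).
  apply: contrapT => H; apply: nirr; split=> [||a b Pab] //.
    exact: monic_neq0.
  case: (boolP (a \is a GRing.unit)) => [|aU]; first by left.
  case: (boolP (b \is a GRing.unit)) => [|bU]; first by right.
  by case: H; exists a, b.
pose c := lead_coef a; have cd : c * lead_coef b = 1.
  by rewrite -lead_coefM -Pab; apply/eqP.
have cU : c \is a GRing.unit by apply/unitrPr; exists (lead_coef b).
have cc : c * c = 1.
  by move: cU; rewrite unfold_in /= => /orP[] /eqP ->.
have cb : lead_coef b = c.
  by rewrite -[LHS]mul1r -cc -mulrA cd mulr1.
have Mon (q : {poly int}) : lead_coef q = c -> c *: q \is monic.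
  by move=> e; rewrite monicE lead_coefZ e cc.
have nz0 (q : {poly int}) : lead_coef q = c -> q != 0.
  by move=> e; rewrite -lead_coef_eq0 e; apply: contraTneq cU => ->;
    rewrite unitr0.
have szgt1 (q : {poly int}) : lead_coef q = c -> q \isn't a GRing.unit ->
    (1 < size q)%N.
  move=> e qU; rewrite ltn_neqAle size_poly_gt0 nz0 // andbT eq_sym.
  apply: contra qU => s1; rewrite poly_unitE s1 /=.
  by move: e; rewrite lead_coefE (eqP s1) /= => ->.
have c0 : c != 0 by rewrite lead_coef_eq0 nz0.
have sz : (size P = (size a + size b).-1)%N.
  by rewrite Pab size_mul ?nz0.
have sa := szgt1 a erefl aU; have sb := szgt1 b cb bU.
have [sA [irrA eA]] : exists s, irreducible_factorization (c *: a) s.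
  apply: IHn; last exact: Mon.
  rewrite size_scale //; apply: leq_trans szP; rewrite sz.
  by case: (size b) sb => [|[|k]] // _; rewrite !addnS ltnS leq_addr.
have [sB [irrB eB]] : exists s, irreducible_factorization (c *: b) s.
  apply: IHn; last exact: Mon.
  rewrite size_scale //; apply: leq_trans szP; rewrite sz.
  by case: (size a) sa => [|[|k]] // _; rewrite !addSn ltnS leq_addl.
exists (sA ++ sB); split=> [f|].
  by rewrite mem_cat => /orP[/irrA|/irrB].
by rewrite big_cat /= -eA -eB -scalerAl -scalerAr scalerA cc scale1r.
Qed.

Definition poly_norm2 (R : realType) (P : {poly int}) : R :=
  Num.sqrt (\sum_(i < size P) `|(P`_i)%:~R : R| ^+ 2).

Definition is_minimal_poly (R : realType) (x : R) (P : {poly rat}) : Prop :=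
  [/\ P \is monic, root (map_poly ratr P) x &
      forall Q : {poly rat}, Q != 0 -> root (map_poly ratr Q) x ->
        (size P <= size Q)%N].

Definition is_dominant_root (R : rcfType) (P : {poly R}) (x : R) : Prop :=
  root P x /\
  forall z : R[i], root (map_poly (real_complex R) P) z ->
    z != real_complex R x -> `|z| < `|real_complex R x|.

Lemma theta0_exists (R : rcfType) :
  exists2 x : R, is_dominant_root ('X^3 - 'X - 1) x &
    33 / 25 < x < 53 / 40.
Proof.
have ev (x : R) : ('X^3 - 'X - 1 : {poly R}).[x] = x ^+ 3 - x - 1.
  by rewrite !hornerE.
have [||x /andP[x1 x2] rx] := @poly_ivt R ('X^3 - 'X - 1)
  (33 / 25) (53 / 40); rewrite ?ev.
- lra.
- by apply/andP; split; lra.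
have ex : x ^+ 3 - x - 1 = 0 by rewrite -ev; apply/eqP.
exists x; last first.
  rewrite !lt_neqAle x1 x2 !andbT; apply/andP; split; apply/eqP => e.
    by rewrite -e in ex; lra.
  by rewrite e in ex; lra.
split=> // z.
rewrite rmorphB rmorphB /= rmorph1 map_polyXn map_polyX.
rewrite rootE !hornerE => /eqP zE ne.
have xE : (real_complex R x) ^+ 3 - real_complex R x - 1 = 0.
  by rewrite -rmorphXn -(rmorph1 (real_complex R)) -!rmorphB /= ex rmorph0.
have quad : z ^+ 2 + real_complex R x * z + real_complex R x ^+ 2 - 1 = 0.
  apply: (@mulfI _ (z - real_complex R x)); first by rewrite subr_eq0.
  rewrite mulr0; transitivity ((z ^+ 3 - z - 1) -
    ((real_complex R x) ^+ 3 - real_complex R x - 1)); first by ring.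
  by rewrite zE xE subr0.
case: z ne quad {zE} => a b _; rewrite !expr2.
move=> /eqP; rewrite eq_complex /= => /andP[/eqP re /eqP im].
have bE : b * (2 * a + x) = 0 by rewrite -im; ring.
have abE : a ^+ 2 + b ^+ 2 = x ^+ 2 - 1.
  move/eqP: bE; rewrite mulf_eq0 => /orP[/eqP b0|/eqP aE]; last first.
    have : a = - x / 2 by lra.
    by move=> e; move: re; rewrite e; lra.
  have xx : 33 / 25 * (33 / 25) <= x * x by apply: ler_pM; lra.
  by exfalso; have := sqr_ge0 (a + x / 2); move: re; rewrite b0; lra.
by rewrite !normc_def /= ltcR abE ltr_sqrt; nra.
Qed.

(* Main.v *)
Require Import Defs.
From mathcomp Require Import all_boot all_order all_algebra all_field.
From mathcomp Require Import complex ring lra zify.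
From mathcomp Require Import boolp reals exp.

(** Write M(f) for the Mahler measure.  Landau's inequality gives
    M(P) < ||P||_2, and M is multiplicative, so it suffices to have Smyth's
    theorem: M(f) >= theta0 for every monic f in Z[X] with f(0) <> 0 and
    f <> +-f*.

    Both facts come from one algebraic statement: multiplication by a finite
    Blaschke product does not increase the 2-norm of truncated power series.
    For Landau, reflect in the unit circle the roots lying outside it.  For
    Smyth, assume f(0) = +-1 and split the roots into those inside and outside
    the circle; then f(0) f / f* = C / D with C, D inner and
    C(0) = D(0) = 1 / M(f) =: x, while the left side is an integer power series
    1 + a_k X^k + a_l X^l + ....  An inner function satisfies
    |[X^n] C q^2| <= ||q||^2 for all real polynomials q.  Testing with
    q = 1 + s X^k + t X^(2k) when l >= 2k, and with
    q = 1 + g X^(l-k) + b X^k + d X^l when l < 2k, yields x^3 + x^2 <= 1, which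
    says 1 / x >= theta0. *)

Set Implicit Arguments.
Unset Strict Implicit.
Unset Printing Implicit Defensive.

Import Order.TTheory GRing.Theory Num.Theory.
Local Open Scope ring_scope.

(** * Coefficient bounds for inner functions *)

Section HankelBounds.
Variable R : realFieldType.
Implicit Types (C D q : {poly R}) (n N j k : nat).

(** The coefficient of X^n in C q^2 is the quadratic form of the real symmetric Hankel matrix with
    entries C_(n-i-j), so this is the contraction property tested on vectors. The cutoff [N] is
    there because [C] stands for a truncated power series. *)
Definition hankel_bounded N C : Prop :=
  forall n q, (n < N)%N -> `|(C * q ^+ 2)`_n| <= \sum_(i < n.+1) q`_i ^+ 2.

Lemma sum_sqr_coef_addXn n q m (c : R) : q`_m = 0 ->
  \sum_(i < n.+1) (q + c *: 'X^m)`_i ^+ 2 <= \sum_(i < n.+1) q`_i ^+ 2 + c ^+ 2.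
Proof.
move=> qm; have [mn|nm] := ltnP m n.+1; last first.
  rewrite ler_wpDr ?sqr_ge0 // ler_sum // => i _.
  by rewrite !coefE (ltn_eqF (leq_trans (ltn_ord i) nm)) mulr0 addr0.
rewrite (bigD1 (Ordinal mn)) //= [X in _ <= X + _](bigD1 (Ordinal mn)) //=.
rewrite !coefE qm eqxx expr0n /= add0r add0r mulr1 addrC lerD2r ler_sum // => i.
by rewrite -val_eqE /= => im; rewrite !coefE (negbTE im) mulr0 addr0.
Qed.

Lemma sum_sqr_coef1 n : \sum_(i < n.+1) (1 : {poly R})`_i ^+ 2 = 1.
Proof.
rewrite big_ord_recl big1 ?addr0 ?coef1 ?expr1n // => i _.
by rewrite coef1 /= expr0n.
Qed.

Lemma hankel_bounded1 N C j (t : R) : hankel_bounded N C ->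
  (0 < j < N)%N -> `|C`_j + 2 * t * C`_0| <= 1 + t ^+ 2.
Proof.
move=> hC /andP[j0 jN]; have := hC j (1 + t *: 'X^j) jN.
have q1 : (1 : {poly R})`_j = 0 by rewrite coef1 (gtn_eqF j0).
move=> /le_trans/(_ (sum_sqr_coef_addXn j t q1)).
rewrite sum_sqr_coef1; congr (`|_| <= _).
have -> : C * (1 + t *: 'X^j) ^+ 2 =
    C + (2 * t) *: (C * 'X^j) + (t ^+ 2) *: (C * 'X^(j + j)).
  by rewrite exprD -!mul_polyC !rmorphM /= ?rmorphXn /= ?polyC_natr; ring.
rewrite !coefE ?coefMXn !(ltnn, subnn).
have -> : (j < j + j)%N by lia.
by rewrite mulr0 addr0.
Qed.

Lemma hankel_bounded2 N C k (s t : R) : hankel_bounded N C ->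
  (0 < k)%N -> (k + k < N)%N ->
  `|C`_(k + k) + 2 * s * C`_k + (s ^+ 2 + 2 * t) * C`_0|
  <= 1 + s ^+ 2 + t ^+ 2.
Proof.
move=> hC k0 kN; have := hC (k + k)%N (1 + s *: 'X^k + t *: 'X^(k + k)) kN.
have q1 : (1 : {poly R})`_k = 0 by rewrite coef1 (gtn_eqF k0).
have q2 : (1 + s *: 'X^k : {poly R})`_(k + k) = 0.
  rewrite coefD coef1 coefZ coefXn.
  have -> : (k + k == 0)%N = false by lia.
  have -> : (k + k == k)%N = false by lia.
  by rewrite mulr0 addr0.
move=> /le_trans/(_ (sum_sqr_coef_addXn _ t q2)).
move=> /le_trans/(_ (lerD (sum_sqr_coef_addXn _ s q1) (lexx _))).
rewrite sum_sqr_coef1; congr (`|_| <= _).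
have -> : C * (1 + s *: 'X^k + t *: 'X^(k + k)) ^+ 2 =
    C + (2 * s) *: (C * 'X^k) + (s ^+ 2 + 2 * t) *: (C * 'X^(k + k))
    + (2 * s * t) *: (C * 'X^(k + k + k))
    + (t ^+ 2) *: (C * 'X^(k + k + k + k)).
  by rewrite !exprD -!mul_polyC !rmorphD !rmorphM /= ?rmorphXn /= ?polyC_natr;
    ring.
rewrite !coefE ?coefMXn !(ltnn, subnn) addnK.
have -> : (k + k < k)%N = false by lia.
have -> : (k + k < k + k + k)%N by lia.
have -> : (k + k < k + k + k + k)%N by lia.
by rewrite !mulr0 !addr0.
Qed.

(** Here j plays the role of l - k and j + k that of l. Of all the terms of degree two in g, b, d,
    only g b and g^2 survive, because 2j < j + k. *)
Lemma hankel_bounded3 N C j k (g b d : R) : hankel_bounded N C ->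
  (0 < j < k)%N -> (j + k < N)%N ->
  `|C`_(j + k) + 2 * g * C`_k + 2 * b * C`_j + (2 * d + 2 * g * b) * C`_0
    + g ^+ 2 * C`_(k - j)| <= 1 + g ^+ 2 + b ^+ 2 + d ^+ 2.
Proof.
move=> hC /andP[j0 jk] kN.
have := hC (j + k)%N (1 + g *: 'X^j + b *: 'X^k + d *: 'X^(j + k)) kN.
have q1 : (1 : {poly R})`_j = 0 by rewrite coef1 (gtn_eqF j0).
have q2 : (1 + g *: 'X^j : {poly R})`_k = 0.
  rewrite coefD coef1 coefZ coefXn.
  by rewrite !gtn_eqF ?mulr0 ?addr0 // (ltn_trans j0).
have q3 : (1 + g *: 'X^j + b *: 'X^k : {poly R})`_(j + k) = 0.
  rewrite !coefD coef1 !coefZ !coefXn.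
  have -> : (j + k == 0)%N = false by lia.
  have -> : (j + k == j)%N = false by lia.
  have -> : (j + k == k)%N = false by lia.
  by rewrite !mulr0 !addr0.
move=> /le_trans/(_ (sum_sqr_coef_addXn _ d q3)).
move=> /le_trans/(_ (lerD (sum_sqr_coef_addXn _ b q2) (lexx _))).
move=> /le_trans/(_ (lerD (lerD (sum_sqr_coef_addXn _ g q1) (lexx _)) (lexx _))).
rewrite sum_sqr_coef1; congr (`|_| <= _).
have -> : C * (1 + g *: 'X^j + b *: 'X^k + d *: 'X^(j + k)) ^+ 2 =
    C + (2 * g) *: (C * 'X^j) + (2 * b) *: (C * 'X^k)
    + (2 * d + 2 * g * b) *: (C * 'X^(j + k)) + (g ^+ 2) *: (C * 'X^(j + j))
    + (b ^+ 2) *: (C * 'X^(k + k)) + (2 * g * d) *: (C * 'X^(j + j + k))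
    + (2 * b * d) *: (C * 'X^(j + k + k))
    + (d ^+ 2) *: (C * 'X^(j + k + (j + k))).
  by rewrite !exprD -!mul_polyC !rmorphD !rmorphM /= ?rmorphXn /= ?polyC_natr;
    ring.
rewrite !coefE ?coefMXn !(ltnn, subnn) addKn addnK.
have -> : (j + k < j)%N = false by lia.
have -> : (j + k < k)%N = false by lia.
have -> : (j + k < j + j)%N = false by lia.
have -> : (j + k < k + k)%N by lia.
have -> : (j + k < j + j + k)%N by lia.
have -> : (j + k < j + k + k)%N by lia.
have -> : (j + k < j + k + (j + k))%N by lia.
have -> : (j + k - (j + j))%N = (k - j)%N by lia.
by rewrite !mulr0 !addr0.
Qed.

Lemma hankel_bounded_coef N C j : hankel_bounded N C -> (0 < j < N)%N ->
  `|C`_j| <= 1 - C`_0 ^+ 2.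
Proof.
move=> hC jN; rewrite ler_norml.
(* The choice t = C_0 gives the upper bound and t = -C_0 the lower one. *)
have := hankel_bounded1 (C`_0) hC jN; have := hankel_bounded1 (- C`_0) hC jN.
by rewrite !ler_norml => /andP[? ?] /andP[? ?]; apply/andP; split; lra.
Qed.

Lemma hankel_bounded_coef2 N C k : hankel_bounded N C ->
  (0 < k)%N -> (k + k < N)%N -> 0 < C`_0 < 1 ->
  C`_(k + k) <= 1 - C`_0 ^+ 2 - C`_k ^+ 2 / (1 - C`_0) /\
  - C`_(k + k) <= 1 - C`_0 ^+ 2 - C`_k ^+ 2 / (1 + C`_0).
Proof.
move=> hC k0 kN /andP[x0 x1]; set x := C`_0 in x0 x1 *; set c := C`_k.
(* Each pair (s, t) is the exact optimum: it minimises the quadratic bound on C_(2k), respectively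
   on -C_(2k). *)
have := hankel_bounded2 (c / (1 - x)) x hC k0 kN.
have := hankel_bounded2 (- c / (1 + x)) (- x) hC k0 kN.
rewrite !ler_norml -/x -/c => /andP[h1 _] /andP[_ h2]; split.
  have e : c / (1 - x) * (1 - x) = c by rewrite divfK //; lra.
  rewrite (_ : c ^+ 2 / (1 - x) = c / (1 - x) * c); last first.
    by rewrite -{2}e; field; lra.
  move: h2 e; set s := c / (1 - x) => h2 e; rewrite -e in h2 *; nra.
rewrite mulNr in h1.
have e : c / (1 + x) * (1 + x) = c by rewrite divfK //; lra.
rewrite (_ : c ^+ 2 / (1 + x) = c / (1 + x) * c); last first.
  by rewrite -{2}e; field; lra.
move: h1 e; set s := c / (1 + x) => h1 e; rewrite -e in h1 *; nra.
Qed.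

End HankelBounds.

(** * The extremal problem behind Smyth's theorem *)

Section SmythExtremal.
Variable R : realFieldType.
Implicit Types (C D : {poly R}) (N j k : nat).

(** The fraction 117/155 = 0.75484 lies just below 1/theta0 = 0.75488, the real root of x^3 + x^2 =
    1. The numerical contradictions below rely on it. *)
Lemma plastic_gt (x : R) : 0 < x -> 1 < x ^+ 3 + x ^+ 2 -> 117 / 155 < x.
Proof.
move=> x0 h; rewrite ltNge; apply/negP => xle.
have x2 : x ^+ 2 <= (117 / 155) ^+ 2.
  by rewrite lerXn2r ?nnegrE ?(ltW x0) //; clear; lra.
have x3 : x ^+ 3 <= (117 / 155) ^+ 3.
  by rewrite lerXn2r ?nnegrE ?(ltW x0) //; clear; lra.
by clear -h x2 x3; lra.
Qed.

Lemma smyth_double_gap_numeric (x u : R) : 0 < x < 1 ->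
  1 < x ^+ 3 + x ^+ 2 -> u <= 1 - x ^+ 2 ->
  2 * (1 - x ^+ 2) - (u - x) ^+ 2 / (1 - x) - u ^+ 2 / (1 + x) < x - u.
Proof.
move=> /andP[x0 x1] xgt uw; have x34 := plastic_gt x0 xgt.
have w0 : 0 < 1 - x ^+ 2 by rewrite subr_gt0 expr_lt1 // ltW.
rewrite -(ltr_pM2r w0).
have -> : (2 * (1 - x ^+ 2) - (u - x) ^+ 2 / (1 - x) - u ^+ 2 / (1 + x))
    * (1 - x ^+ 2) = 2 * (1 - x ^+ 2) ^+ 2 - (u - x) ^+ 2 * (1 + x)
    - u ^+ 2 * (1 - x).
  by field; rewrite !gt_eqF //; clear -x0 x1; lra.
have e5 : 0 <= 5 * x ^+ 2 + 2 * x - 3 by clear -x34; nra.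
(* The worst case is u = 1 - x^2, that is e = 0, where the difference of the two sides is exactly (x
   + 1)(x^3 + x^2 - 1). A positive e only adds e (5x^2 + 2x - 3) + 2e^2. *)
have [e e0 ->] : exists2 e, 0 <= e & u = 1 - x ^+ 2 - e.
  by exists (1 - x ^+ 2 - u); [rewrite subr_ge0 | ring].
have p1 : 0 < (x + 1) * (x ^+ 3 + x ^+ 2 - 1).
  by rewrite mulr_gt0 ?subr_gt0 // addr_gt0.
have p2 : 0 <= e * (5 * x ^+ 2 + 2 * x - 3) by rewrite mulr_ge0.
have p3 : 0 <= 2 * e ^+ 2 by rewrite mulr_ge0 // sqr_ge0.
rewrite -subr_gt0; apply: (lt_le_trans p1).
rewrite -subr_ge0; apply: (le_trans (addr_ge0 p2 p3)).
by rewrite le_eqVlt; apply/orP; left; apply/eqP; ring.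
Qed.

(* Both coefficients of X^(2k) are confined to intervals determined by those of
   X^k, and x^3 + x^2 = 1 is the threshold at which these become compatible. *)
Lemma smyth_double_gap N C D k (a : int) :
  hankel_bounded N C -> hankel_bounded N D -> (0 < k)%N -> (k + k < N)%N ->
  0 < C`_0 < 1 -> D`_0 = C`_0 -> C`_k = D`_k + C`_0 ->
  C`_(k + k) = D`_(k + k) + D`_k + a%:~R * C`_0 ->
  C`_0 ^+ 3 + C`_0 ^+ 2 <= 1.
Proof.
move=> hC hD k0 kN x01 D0 Ck C2k.
have k0N : (0 < k < N)%N by lia.
have := hankel_bounded_coef hC k0N; have := hankel_bounded_coef hD k0N.
have [] := hankel_bounded_coef2 hC k0 kN x01.
have [] := hankel_bounded_coef2 hD k0 kN; rewrite D0 //.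
move: Ck C2k x01; set x := C`_0; set c := C`_k; set d := D`_k.
set c2 := C`_(k + k); set d2 := D`_(k + k) => Ck C2k /andP[x0 x1].
move=> d2u d2l c2u c2l; rewrite !ler_norml => /andP[dl du] /andP[cl cu].
rewrite leNgt; apply/negP => xgt.
have x01 : 0 < x < 1 by rewrite x0.
(* Integrality keeps a x out of the open interval from 0 to x. If a <= 0, the upper bound on d2
   clashes with the lower bound on c2; if a >= 1, the opposite pair clashes. *)
have [a0|a1] : (a <= 0) \/ (1 <= a) by clear; lia.
  have ax : a%:~R * x <= 0 by rewrite mulr_le0_ge0 ?lerz0 // ltW.
  have := smyth_double_gap_numeric x01 xgt cu.
  have -> : c - x = d by rewrite Ck addrK.
  move: ax c2u c2l d2u d2l C2k Ck; set s := a%:~R * x.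
  set A := d ^+ 2 / _; set B := c ^+ 2 / (1 + x); set w := x ^+ 2.
  by clear; lra.
have ax : x <= a%:~R * x by rewrite ler_peMl ?ler1z // ltW.
have du' : - d <= 1 - x ^+ 2 by rewrite lerNl.
have := smyth_double_gap_numeric x01 xgt du'.
have -> : - d - x = - c by rewrite Ck opprD.
rewrite !sqrrN.
move: ax c2u c2l d2u d2l C2k Ck; set s := a%:~R * x.
set A := c ^+ 2 / _; set B := d ^+ 2 / (1 + x); set w := x ^+ 2.
by clear; lra.
Qed.

(** For fixed b the optimal parameters are g = x (1 + 2b) / 2 and d = x for the upper bound on y,
    and their negatives for the lower bound. *)
Lemma smyth_short_gap_numeric (x y : R) (a : int) :
  0 < x -> 1 < x ^+ 3 + x ^+ 2 -> `|y| <= 1 - x ^+ 2 -> a != 0 ->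
  (forall g b d : R,
     `|y + a%:~R * x + 2 * g * x + 4 * b * y + 4 * d * x + 4 * g * b * x|
     <= 2 * (1 + g ^+ 2 + b ^+ 2 + d ^+ 2)) -> False.
Proof.
wlog a0 : y a / 0 < a => [H|].
  move=> x0 xg yx; rewrite neq_lt => /orP[an|ap] h; last first.
    by apply: (H y a) => //; rewrite gt_eqF.
  apply: (H (- y) (- a)); rewrite ?normrN ?oppr_eq0 ?lt_eqF ?oppr_gt0 //.
  move=> g b d; have := h (- g) b (- d); rewrite -normrN !sqrrN.
  by congr (`|_| <= _); rewrite rmorphN /=; ring.
move=> x0 xg yx _ h; have x34 := plastic_gt x0 xg.
have x2 : (117 / 155) ^+ 2 < x ^+ 2.
  by rewrite ltrXn2r ?nnegrE ?(ltW x0) //; clear; lra.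
(* The parameters b nearly optimise the two bounds on y. *)
have := h (2 / 3 * x) (1 / 6) x.
have := h (- (5 / 3) * x) (7 / 6) (- x).
have := h (x / 2) 0 x.
move: yx; rewrite !ler_norml => /andP[yl yu] /andP[_ h1] /andP[h2 _] /andP[_ h3].
(* For a = 1 the upper bound on y at b = 1/6 falls narrowly below the lower bound at b = 7/6. For a
   >= 2 the bound at b = 0 already contradicts y >= -(1 - x^2). *)
have [a1|a2] : (a = 1) \/ (2 <= a) by clear -a0; lia.
  rewrite a1 in h2 h3; clear -x34 x2 h2 h3; lra.
have : 2 * x <= a%:~R * x by rewrite ler_wpM2r ?(ltW x0) // (ler_int _ 2).
by clear -x34 x2 yl h1; lra.
Qed.

(** Subtracting the bound for D at (g, -b, -d) from the one for C at (g, b, d) cancels every unknown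
    coefficient except y = C_j. *)
Lemma smyth_short_gap N C D j k (a : int) :
  hankel_bounded N C -> hankel_bounded N D -> (0 < j < k)%N ->
  (j + k < N)%N -> 0 < C`_0 -> (forall i, (i < k)%N -> D`_i = C`_i) ->
  C`_k = D`_k + C`_0 -> C`_(j + k) = D`_(j + k) + C`_j + a%:~R * C`_0 ->
  a != 0 -> C`_0 ^+ 3 + C`_0 ^+ 2 <= 1.
Proof.
move=> hC hD jk kN x0 CD Ck Cl a0; rewrite leNgt; apply/negP => xgt.
have jN : (0 < j < N)%N by lia.
apply: (smyth_short_gap_numeric x0 xgt (hankel_bounded_coef hC jN) a0).
move=> g b d.
have := hankel_bounded3 g b d hC jk kN.
have := hankel_bounded3 g (- b) (- d) hD jk kN.
have [jk' kj k0] : [/\ (j < k)%N, (k - j < k)%N & (0 < k)%N] by split; lia.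
rewrite (CD j) // (CD (k - j)%N) // (CD 0%N) // Ck Cl.
rewrite !sqrrN => hd hc.
have := lerD hc hd; rewrite -[X in _ + X <= _]normrN => h.
have := le_trans (ler_normD _ _) h; congr (`|_| <= _); ring.
Qed.

Lemma smyth_extremal N C D (a : nat -> int) k :
  hankel_bounded N C -> hankel_bounded N D -> (0 < k)%N -> (k + k < N)%N ->
  0 < C`_0 ->
  (forall n, (n < N)%N -> C`_n = \sum_(i < n.+1) (a i)%:~R * D`_(n - i)) ->
  a 0%N = 1 -> (forall i, (0 < i < k)%N -> a i = 0) -> a k != 0 ->
  C`_0 ^+ 3 + C`_0 ^+ 2 <= 1.
Proof.
move=> hC hD k0 kN x0 conv a0 ai ak.
have D0 : D`_0 = C`_0.
  by rewrite conv ?big_ord1 ?a0 ?mul1r //; lia.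
have CDi i : (i < k)%N -> D`_i = C`_i.
  move=> ik; rewrite conv; last by lia.
  rewrite big_ord_recl a0 mul1r subn0 big1 ?addr0 // => m _.
  by rewrite ai ?mul0r //= /bump; have := ltn_ord m; lia.
have CDk : C`_k = D`_k + (a k)%:~R * C`_0.
  rewrite conv; last by lia.
  rewrite big_ord_recl a0 mul1r subn0; congr (_ + _).
  case: k k0 ai ak {kN CDi} => // k _ ai ak.
  rewrite big_ord_recr /= /bump /= add1n subnn D0 big1 ?add0r // => m _.
  by rewrite ai ?mul0r //=; have := ltn_ord m; lia.
have CDl n : (k < n < N)%N -> (forall i, (k < i < n)%N -> a i = 0) ->
    C`_n = D`_n + (a k)%:~R * D`_(n - k) + (a n)%:~R * C`_0.
  move=> /andP[kn nN] an; rewrite conv // (bigD1 ord0) //= a0 mul1r subn0.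
  have kn' : (k < n.+1)%N by lia.
  rewrite (bigD1 (Ordinal kn')) /=; last by rewrite -val_eqE /=; lia.
  rewrite (bigD1 ord_max) /=; last by rewrite -!val_eqE /=; lia.
  rewrite subnn D0 big1 ?addr0 ?addrA // => i; rewrite -!val_eqE /= => ii.
  have [/ai ->|ik] := boolP (0 < i < k)%N; first by rewrite mul0r.
  by rewrite an ?mul0r //; have := ltn_ord i; lia.
rewrite leNgt; apply/negP => xgt; have x34 := plastic_gt x0 xgt.
have x2 : (117 / 155) ^+ 2 < C`_0 ^+ 2.
  by rewrite ltrXn2r ?nnegrE ?(ltW x0) //; clear; lra.
have k0N : (0 < k < N)%N by lia.
have := hankel_bounded_coef hC k0N; have := hankel_bounded_coef hD k0N.
rewrite D0 !ler_norml => /andP[dl du] /andP[cl cu].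
(* Both C_k and D_k are at most 1 - x^2 in modulus, so |a_k| x <= 2 (1 - x^2) < 2x. *)
have ak1 : a k = 1 \/ a k = -1.
  have [|[|[]]] : a k = 1 \/ a k = -1 \/ 2 <= a k \/ a k <= -2.
    by move: ak; clear; lia.
  - by left.
  - by right.
  - move=> h; exfalso; have : 2 * C`_0 <= (a k)%:~R * C`_0.
      by rewrite ler_wpM2r ?(ltW x0) // (ler_int _ 2).
    by move: dl cu x34 x2 CDk; clear; lra.
  - move=> h; exfalso; have : (a k)%:~R * C`_0 <= (-2) * C`_0.
      by rewrite ler_wpM2r ?(ltW x0) // (ler_int _ _ (-2)).
    by move: du cl x34 x2 CDk; clear; lra.
have x1 : 0 < C`_0 < 1.
  rewrite x0 /= -(@expr_lt1 _ 2) ?(ltW x0) //.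
  by case: ak1 CDk => -> /=; rewrite ?mulN1r ?mul1r;
    move: dl du cu cl x34; clear; lra.
clear dl du cl cu x34 x2 conv.
suff : C`_0 ^+ 3 + C`_0 ^+ 2 <= 1 by rewrite leNgt xgt.
(* Either some a_n with k < n < 2k is nonzero, the least such n being l, or the coefficient to
   compare next is that of X^(2k). *)
have [[n /andP[/andP[kn n2k] an0]]|noa] :=
    pselect (exists n, (k < n < k + k)%N && (a n != 0)).
  have ex : exists n, (k < n < k + k)%N && (a n != 0).
    by exists n; rewrite kn n2k.
  case: (ex_minnP ex) => l /andP[/andP[kl l2k] al] lmin {n kn n2k an0 ex}.
  have lN : (k < l < N)%N by lia.
  have Cl : C`_l = D`_l + (a k)%:~R * D`_(l - k) + (a l)%:~R * C`_0.
    apply: CDl => // i il; apply/eqP; apply: contraT => ai0.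
    by have := lmin i; rewrite ai0; lia.
  have jk : (0 < l - k < k)%N by lia.
  have jkN : (l - k + k < N)%N by lia.
  have lE : (l - k + k)%N = l by lia.
  have jk' : (l - k < k)%N by lia.
  (* When a_k = -1, exchange C and D: the quotient becomes 1/a = 1 + X^k - a_l X^l + ..., which is
     again of the required shape. *)
  case: ak1 => ak1; rewrite ak1 /= in CDk Cl.
    apply: (smyth_short_gap hC hD jk jkN x0 CDi _ _ al).
      by rewrite CDk mul1r.
    by rewrite lE Cl mul1r -CDi.
  rewrite -D0; apply: (smyth_short_gap (a := - a l) hD hC jk jkN).
  - by rewrite D0.
  - by move=> i ik; rewrite CDi.
  - by rewrite CDk D0 mulN1r addrNK.
  - by rewrite lE Cl D0 rmorphN /= mulN1r; ring.
  - by rewrite oppr_eq0.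
have C2k : C`_(k + k) = D`_(k + k) + (a k)%:~R * D`_k + (a (k + k)%N)%:~R * C`_0.
  rewrite CDl ?addnK //; first by lia.
  move=> i ik; apply/eqP; apply: contraT => ai0.
  by case: noa; exists i; rewrite ik.
case: ak1 => ak1; rewrite ak1 /= in CDk C2k.
  apply: (smyth_double_gap (a := a (k + k)%N) hC hD k0 kN x1 D0).
    by rewrite CDk mul1r.
  by rewrite C2k mul1r.
(* If a = 1 - X^k + a_(2k) X^(2k) + ..., then 1/a has coefficient 1 - a_(2k) at X^(2k). *)
rewrite -D0; apply: (smyth_double_gap (a := 1 - a (k + k)%N) hD hC k0 kN).
- by rewrite D0.
- by rewrite D0.
- by rewrite CDk D0 mulN1r addrNK.
- by rewrite C2k CDk D0 rmorphB /=; ring.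
Qed.

End SmythExtremal.

(** * Truncated power series and Blaschke products *)

Definition eqmodXn (R : nzRingType) (N : nat) (p q : {poly R}) : Prop :=
  forall i, (i < N)%N -> p`_i = q`_i.

Section EqModXn.
Variable R : comUnitRingType.
Implicit Types (p q r : {poly R}) (N : nat).

Lemma eqmodXn_refl N p : eqmodXn N p p. Proof. by []. Qed.

Lemma eqmodXn_sym N p q : eqmodXn N p q -> eqmodXn N q p.
Proof. by move=> h i iN; rewrite h. Qed.

Lemma eqmodXn_trans N p q r : eqmodXn N p q -> eqmodXn N q r -> eqmodXn N p r.
Proof. by move=> h h' i iN; rewrite h ?h'. Qed.

Lemma eqmodXnM N p p' q q' :
  eqmodXn N p p' -> eqmodXn N q q' -> eqmodXn N (p * q) (p' * q').
Proof.
move=> hp hq i iN; rewrite !coefM; apply: eq_bigr => j _.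
by rewrite hp ?hq //; have := ltn_ord j; lia.
Qed.

Lemma eqmodXn_inv N p : p`_0 \is a GRing.unit ->
  exists r, eqmodXn N (p * r) 1.
Proof.
move=> pU; elim: N => [|N [r hr]]; first by exists 0.
exists (r + (((1 : {poly R})`_N - (p * r)`_N) / p`_0) *: 'X^N) => i.
rewrite ltnS leq_eqVlt mulrDr -scalerAr coefD coefZ coefMXn.
move=> /orP[/eqP->|iN]; last by rewrite iN mulr0 addr0 hr.
by rewrite ltnn subnn divrK // addrC subrK.
Qed.

Lemma eqmodXn_div N p q : p`_0 \is a GRing.unit ->
  exists r, eqmodXn N (r * p) q.
Proof.
move=> /(@eqmodXn_inv N)[r hr]; exists (q * r).
rewrite -mulrA -[X in eqmodXn _ _ X]mulr1; apply: eqmodXnM => //.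
by rewrite mulrC.
Qed.

Lemma eqmodXn_mulI N p q r : p`_0 \is a GRing.unit ->
  eqmodXn N (p * q) (p * r) -> eqmodXn N q r.
Proof.
move=> /(@eqmodXn_inv N)[s hs] h.
have h' (t : {poly R}) : eqmodXn N t (s * (p * t)).
  rewrite -{1}[t]mul1r mulrA; apply: eqmodXnM => //.
  by rewrite mulrC; apply: eqmodXn_sym.
apply: (eqmodXn_trans (h' q)); apply: eqmodXn_sym.
apply: (eqmodXn_trans (h' r)); apply: eqmodXn_sym.
exact: eqmodXnM.
Qed.

End EqModXn.

Section Blaschke.
Variable R : rcfType.
Local Notation C := R[i].
Implicit Types (G H : {poly C}) (L : seq (C * C)) (N : nat).

(** The squared modulus is taken in [R], whereas the norm of [R[i]] has its values in [R[i]]. *)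
Definition sqnormc (z : C) : R := complex.Re z ^+ 2 + complex.Im z ^+ 2.

Lemma sqnormc_ge0 z : 0 <= sqnormc z.
Proof. by rewrite addr_ge0 ?sqr_ge0. Qed.

Lemma sqnormcM z w : sqnormc (z * w) = sqnormc z * sqnormc w.
Proof. by case: z w => [a b] [c d]; rewrite /sqnormc /=; ring. Qed.

Lemma sqnormc_eq0 z : (sqnormc z == 0) = (z == 0).
Proof. by rewrite paddr_eq0 ?sqr_ge0 // !sqrf_eq0 eq_complex. Qed.

Lemma sqnormc0 : sqnormc 0 = 0.
Proof. by apply/eqP; rewrite sqnormc_eq0. Qed.

(** Energy balance of one Blaschke step: new state energy minus old state energy is a multiple of
    input energy minus output energy. *)
Lemma sqnormc_reflect (p q g h : C) :
  sqnormc (p^*%C * h - q * g) - sqnormc (p * g - q^*%C * h) =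
  (sqnormc p - sqnormc q) * (sqnormc h - sqnormc g).
Proof.
by case: p q g h => [p1 p2] [q1 q2] [g1 g2] [h1 h2]; rewrite /sqnormc /=; ring.
Qed.

Lemma coef_mul_linear G (p q : C) i :
  (G * (p%:P + q *: 'X))`_i = p * G`_i + (if i is j.+1 then q * G`_j else 0).
Proof.
rewrite mulrDr -scalerAr coefD coefMC coefZ coefMX mulrC.
by case: i => [|i] /=; rewrite ?mulr0.
Qed.

(* The rational inner factor (q^* + p^* X) / (p + q X) is realised by a unitary
   2x2 system whose state is p^* h - q g: energy is conserved at every step. *)
Lemma blaschke_step N G H (p q : C) : p != 0 -> sqnormc q <= sqnormc p ->
  eqmodXn N (G * (p%:P + q *: 'X)) (H * (q^*%C%:P + p^*%C *: 'X)) ->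
  \sum_(i < N) sqnormc G`_i <= \sum_(i < N) sqnormc H`_i.
Proof.
move=> p0 qp GH.
have S0 : (0 < N)%N -> p * G`_0 - q^*%C * H`_0 = 0.
  by move=> /GH; rewrite !coef_mul_linear !addr0 => ->; rewrite subrr.
have Sn n : (n.+1 < N)%N ->
    p * G`_n.+1 - q^*%C * H`_n.+1 = p^*%C * H`_n - q * G`_n.
  move=> /GH; rewrite !coef_mul_linear => e.
  by rewrite (canRL (addrK _) e); ring.
have energy n : (n < N)%N -> sqnormc (p^*%C * H`_n - q * G`_n) =
    (sqnormc p - sqnormc q) * \sum_(i < n.+1) (sqnormc H`_i - sqnormc G`_i).
  elim: n => [|n IHn] nN.
    by rewrite big_ord1 -sqnormc_reflect S0 // sqnormc0 subr0.
  rewrite big_ord_recr /= mulrDr -IHn 1?ltnW // -sqnormc_reflect Sn //.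
  by rewrite [RHS]addrC subrK.
(* If |q| < |p|, divide the nonnegative state energy by |p|^2 - |q|^2. If |q| = |p|, the factor is a
   unimodular constant: the state vanishes identically and the inequality holds termwise. *)
have [eqpq|neqpq] := eqVneq (sqnormc q) (sqnormc p); last first.
  rewrite -subr_ge0 -sumrB; case: N energy {GH S0 Sn} => [|N] energy.
    by rewrite big_ord0.
  have := sqnormc_ge0 (p^*%C * H`_N - q * G`_N); rewrite energy //.
  by rewrite pmulr_rge0 // subr_gt0 lt_neqAle neqpq.
have S i : (i < N)%N -> p * G`_i = q^*%C * H`_i.
  move=> iN; apply/eqP; rewrite -subr_eq0; case: i iN => [|i] iN.
    by rewrite S0.
  by rewrite Sn // -sqnormc_eq0 energy 1?ltnW // eqpq subrr mul0r.
apply: ler_sum => i _; have := congr1 sqnormc (S i (ltn_ord i)).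
rewrite !sqnormcM (_ : sqnormc q^*%C = sqnormc q); last first.
  by case: (q) => a b; rewrite /sqnormc /= sqrrN.
rewrite eqpq => /mulfI -> //; by rewrite sqnormc_eq0.
Qed.

(** A pair (p, q) encodes the factor (conj q + X conj p) / (p + q X), unimodular on the unit circle.
    The condition |q| <= |p| in [inner_data] keeps its pole out of the open disc, and equality
    leaves room for roots on the circle. *)
Definition inner_den L : {poly C} := \prod_(w <- L) (w.1%:P + w.2 *: 'X).
Definition inner_num L : {poly C} :=
  \prod_(w <- L) (w.2^*%C%:P + w.1^*%C *: 'X).

Definition inner_data L : Prop :=
  forall w, w \in L -> w.1 != 0 /\ sqnormc w.2 <= sqnormc w.1.

Lemma inner_den0 L : inner_data L -> (inner_den L)`_0 \is a GRing.unit.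
Proof.
elim: L => [_|w L IHL wL]; first by rewrite /inner_den big_nil coef1 unitr1.
rewrite /inner_den big_cons mulrC coef_mul_linear addr0 unitrM.
rewrite unitfE; have [-> _] := wL w (mem_head _ _).
by apply: IHL => v vL; apply: wL; rewrite inE vL orbT.
Qed.

Lemma inner_contraction L N G H : inner_data L ->
  eqmodXn N (G * inner_den L) (H * inner_num L) ->
  \sum_(i < N) sqnormc G`_i <= \sum_(i < N) sqnormc H`_i.
Proof.
elim: L G => [|w L IHL] G wL.
  rewrite /inner_den /inner_num !big_nil !mulr1 => GH.
  by apply: ler_sum => i _; rewrite GH.
have wL' : inner_data L by move=> v vL; apply: wL; rewrite inE vL orbT.
have [w0 w1] := wL w (mem_head _ _).
have LU := inner_den0 wL' => GH.
(* K is the output of the remaining factors applied to H; the factor [w] then takes K to G. *)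
have [K KH] := eqmodXn_div N (H * inner_num L) LU.
apply: le_trans (IHL K wL' KH).
apply: (@blaschke_step _ _ _ w.1 w.2) => //.
apply: (eqmodXn_mulI LU).
have -> : inner_den L * (G * (w.1%:P + w.2 *: 'X)) = G * inner_den (w :: L).
  by rewrite /inner_den big_cons; ring.
apply: (eqmodXn_trans GH).
have -> : H * inner_num (w :: L) =
    (w.2^*%C%:P + w.1^*%C *: 'X) * (H * inner_num L).
  by rewrite /inner_num big_cons; ring.
rewrite [X in eqmodXn _ _ X]mulrA [X in eqmodXn _ _ X]mulrC.
rewrite [inner_den L * K]mulrC; apply: eqmodXnM => //.
exact: eqmodXn_sym.
Qed.

Lemma Re_add (z w : C) : complex.Re (z + w) = complex.Re z + complex.Re w.
Proof. by case: z w => [a b] [c d]. Qed.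

Lemma Re_sum (I : Type) (s : seq I) (F : I -> C) :
  complex.Re (\sum_(i <- s) F i) = \sum_(i <- s) complex.Re (F i).
Proof. exact: (big_morph _ Re_add). Qed.

Lemma Re_mul_real (z : C) (a : R) : complex.Re (z * a%:C%C) = complex.Re z * a.
Proof. by case: z => c d /=; rewrite mulr0 subr0. Qed.

(** Write C q^2 as (C q) q. By 2uv <= u^2 + v^2 its coefficient is at most half of ||C q||^2 +
    ||q||^2, and ||C q|| <= ||q|| by contraction. Taking real parts of the coefficients commutes
    with multiplication by the real q and does not increase the norm. *)
Lemma hankel_bounded_inner L N G (kappa : C) : inner_data L ->
  sqnormc kappa = 1 -> eqmodXn N (G * inner_den L) (kappa *: inner_num L) ->
  hankel_bounded N (map_poly (@complex.Re R) G).
Proof.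
move=> wL k1 GL n q nN; set Gr := map_poly _ G.
pose qC := map_poly (real_complex R) q.
have Grq i : (Gr * q)`_i = complex.Re (G * qC)`_i.
  rewrite !coefM Re_sum; apply: eq_bigr => j _.
  by rewrite coef_map_id0 // coef_map /= Re_mul_real.
have contr : \sum_(i < n.+1) (Gr * q)`_i ^+ 2 <= \sum_(i < n.+1) q`_i ^+ 2.
  have : eqmodXn n.+1 (G * qC * inner_den L) (kappa *: qC * inner_num L).
    have -> : G * qC * inner_den L = G * inner_den L * qC by ring.
    have -> : kappa *: qC * inner_num L = kappa *: inner_num L * qC.
      by rewrite -!scalerAl mulrC.
    apply: eqmodXnM => // i ni.
    by apply: GL; lia.
  move=> /(inner_contraction wL) /(le_trans _) h.
  apply: (le_trans (h _ _)).
    by apply: ler_sum => i _; rewrite Grq lerDl sqr_ge0.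
  apply: ler_sum => i _; rewrite coefZ sqnormcM k1 mul1r coef_map /sqnormc /=.
  by rewrite expr0n addr0.
have -> : Gr * q ^+ 2 = Gr * q * q by rewrite -mulrA.
rewrite coefM -(ler_pM2l (ltr0n R 2)).
have -> : 2%:R * \sum_(i < n.+1) q`_i ^+ 2 =
    \sum_(i < n.+1) q`_i ^+ 2 + \sum_(i < n.+1) q`_(n - i) ^+ 2.
  rewrite [X in _ + X](reindex_inj rev_ord_inj) /=.
  rewrite mulr_natl mulr2n; congr (_ + _); apply: eq_bigr => i _.
  by rewrite subSS subKn // -ltnS.
apply: le_trans (lerD contr (lexx _)).
rewrite -big_split /= -[X in X * _](ger0_norm (ler0n R 2)) -normrM mulr_sumr.
apply: le_trans (ler_norm_sum _ _ _) _; apply: ler_sum => i _.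
set u := (Gr * q)`_i; set v := q`_(n - i).
rewrite ler_norml; apply/andP; split.
  by rewrite -subr_ge0 (_ : _ - _ = (u + v) ^+ 2) ?sqr_ge0 //; ring.
by rewrite -subr_ge0 (_ : _ - _ = (u - v) ^+ 2) ?sqr_ge0 //; ring.
Qed.

End Blaschke.

(** * Reciprocal polynomials and the Mahler measure *)

Section RecipPoly.
Variable R : idomainType.
Implicit Types (p q : {poly R}) (z : R).

Lemma recip_poly_mul_XsubC q z : q != 0 ->
  recip_poly (('X - z%:P) * q) = (1 - z *: 'X) * recip_poly q.
Proof.
move=> q0; have sq : (0 < size q)%N by rewrite size_poly_gt0.
have -> : (1 - z *: 'X) * recip_poly q = recip_poly q - z *: (recip_poly q * 'X).
  by rewrite mulrBl mul1r -scalerAl [_ * 'X]mulrC.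
rewrite mulrC; apply/polyP => i; rewrite coefB coefZ coefMX.
rewrite !coef_poly size_Mmonic ?monicXsubC // size_XsubC addn2 /=.
case qn: (size q) sq => [|n] // _; case: i => [|i] /=.
  rewrite !subn0 mulr0 subr0 mulrBr coefB coefMX coefMC /=.
  by rewrite [q`_n.+1]nth_default ?qn ?mul0r ?subr0.
rewrite !ltnS subSS mulrBr coefB coefMX coefMC mulrC.
have [ilt|ilt|->] := ltngtP i n.
- by rewrite subn_eq0 leqNgt ilt /= subnS.
- by rewrite mulr0 subr0.
- by rewrite subnn.
Qed.

Lemma recip_poly_prod_XsubC (s : seq R) :
  recip_poly (\prod_(z <- s) ('X - z%:P)) = \prod_(z <- s) (1 - z *: 'X).
Proof.
elim: s => [|z s IHs].
  rewrite !big_nil; apply/polyP => i; rewrite coef_poly size_poly1 coef1.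
  by case: i => [|i]; rewrite ?coef1.
rewrite !big_cons recip_poly_mul_XsubC ?IHs //.
exact/monic_neq0/monic_prod_XsubC.
Qed.

Lemma recip_poly_horner1 p : (recip_poly p).[1] = p.[1].
Proof.
rewrite horner_poly horner_coef (reindex_inj rev_ord_inj) /=.
apply: eq_bigr => i _; rewrite !expr1n; congr (p`_ _ * _).
by case: (size p) i => [[]//|n i]; rewrite subSS subKn // -ltnS.
Qed.

End RecipPoly.

Lemma map_recip_poly (R S : nzRingType) (phi : {rmorphism R -> S})
    (p : {poly R}) : injective phi ->
  map_poly phi (recip_poly p) = recip_poly (map_poly phi p).
Proof.
move=> phiI; apply/polyP => i; rewrite coef_map coef_poly [RHS]coef_poly.
rewrite size_map_inj_poly ?rmorph0 //.
by case: ifP => _ /=; rewrite ?coef_map ?rmorph0.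
Qed.

Section LinearProducts.
Variables (F : comNzRingType) (I : Type) (u v : I -> F).

Lemma size_prod_linear (s : seq I) :
  (size (\prod_(i <- s) ((u i)%:P + v i *: 'X))%R <= (size s).+1)%N.
Proof.
elim: s => [|i s IHs]; first by rewrite big_nil size_poly1.
rewrite big_cons; apply: leq_trans (size_polyMleq _ _) _.
have : (size ((u i)%:P + v i *: 'X)%R <= 2)%N.
  rewrite (leq_trans (size_polyD _ _)) // geq_max.
  rewrite (leq_trans (size_polyC_leq1 _)) //=.
  by rewrite (leq_trans (size_scale_leq _ _)) // size_polyX.
by move: IHs => /=; lia.
Qed.

Lemma lead_prod_linear (s : seq I) :
  (\prod_(i <- s) ((u i)%:P + v i *: 'X))`_(size s) = \prod_(i <- s) v i.
Proof.
elim: s => [|i s IHs]; first by rewrite !big_nil coef1.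
rewrite !big_cons mulrDl coefD coefCM -scalerAl coefZ coefXM /= IHs.
by rewrite [_`_(size s).+1]nth_default ?mulr0 ?add0r // size_prod_linear.
Qed.

Lemma coef0_prod_linear (s : seq I) :
  (\prod_(i <- s) ((u i)%:P + v i *: 'X))`_0 = \prod_(i <- s) u i.
Proof.
elim: s => [|i s IHs]; first by rewrite !big_nil coef1.
by rewrite !big_cons mulrDl coefD coefCM -scalerAl coefZ coefXM /= IHs mulr0 addr0.
Qed.

End LinearProducts.

Section Mahler.
Variable R : rcfType.
Local Notation C := R[i].
Implicit Types (rs : seq C) (z : C).

(* The square of the Mahler measure of the monic polynomial with roots rs. *)
Definition sqmahler rs : R := \prod_(z <- rs | 1 < sqnormc z) sqnormc z.

(** These pairs encode (X - z) / (1 - X conj z) for roots in the closed disc and its inverse for the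
    roots outside, so that neither product has a pole in the open disc. *)
Definition inside rs : seq (C * C) :=
  [seq (1, - z^*%C) | z <- rs & ~~ (1 < sqnormc z)].
Definition outside rs : seq (C * C) := [seq (- z, 1) | z <- rs & 1 < sqnormc z].

Lemma sqnormcJ z : sqnormc z^*%C = sqnormc z.
Proof. by case: z => a b; rewrite /sqnormc /= sqrrN. Qed.

Lemma sqnormcN z : sqnormc (- z) = sqnormc z.
Proof. by case: z => a b; rewrite /sqnormc /= !sqrrN. Qed.

Lemma sqnormc_real (a : R) : sqnormc a%:C%C = a ^+ 2.
Proof. by rewrite /sqnormc /= expr0n addr0. Qed.

Lemma sqnormc1 : sqnormc (1 : C) = 1.
Proof. by rewrite (sqnormc_real 1) expr1n. Qed.

Lemma sqnormc_prod (I : Type) (s : seq I) (P : pred I) (F : I -> C) :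
  sqnormc (\prod_(i <- s | P i) F i) = \prod_(i <- s | P i) sqnormc (F i).
Proof. exact: (big_morph (@sqnormc R) (@sqnormcM R) sqnormc1). Qed.

Lemma inside_data rs : inner_data (inside rs).
Proof.
move=> w /mapP[z]; rewrite mem_filter => /andP[zin _] -> /=.
by rewrite oner_neq0 sqnormcN sqnormcJ sqnormc1 leNgt.
Qed.

Lemma outside_data rs : inner_data (outside rs).
Proof.
move=> w /mapP[z]; rewrite mem_filter => /andP[zout _] -> /=.
rewrite sqnormcN sqnormc1 (ltW zout) oppr_eq0; split=> //.
by apply: contraTneq zout => ->; rewrite sqnormc0 ltr10.
Qed.

Lemma inner_den_inside rs :
  inner_den (inside rs) = \prod_(z <- rs | ~~ (1 < sqnormc z)) (1 - z^*%C *: 'X).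
Proof.
rewrite /inner_den big_map big_filter; apply: eq_bigr => z _ /=.
by rewrite scaleNr.
Qed.

Lemma inner_num_inside rs :
  inner_num (inside rs) = \prod_(z <- rs | ~~ (1 < sqnormc z)) ('X - z%:P).
Proof.
rewrite /inner_num big_map big_filter; apply: eq_bigr => z _.
transitivity ((- z^*%C)^*%C%:P + (1 : C)^*%C *: 'X) => //.
by rewrite conjc1 rmorphN /= conjcK scale1r addrC polyCN.
Qed.

Lemma inner_den_outside rs :
  inner_den (outside rs) = \prod_(z <- rs | 1 < sqnormc z) ('X - z%:P).
Proof.
rewrite /inner_den big_map big_filter; apply: eq_bigr => z _ /=.
by rewrite scale1r addrC polyCN.
Qed.

Lemma inner_num_outside rs :
  inner_num (outside rs) = \prod_(z <- rs | 1 < sqnormc z) (1 - z^*%C *: 'X).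
Proof.
rewrite /inner_num big_map big_filter; apply: eq_bigr => z _.
transitivity ((1 : C)^*%C%:P + (- z)^*%C *: 'X) => //.
by rewrite conjc1 rmorphN scaleNr.
Qed.

Lemma sqmahler_ge1 rs : 1 <= sqmahler rs.
Proof.
rewrite /sqmahler; elim/big_ind: _ => // [x y x1 y1|z /ltW //].
by rewrite -[1]mulr1 ler_pM.
Qed.

Lemma sqnormc_den_outside0 rs :
  sqnormc (inner_den (outside rs))`_0 = sqmahler rs.
Proof.
rewrite /inner_den coef0_prod_linear sqnormc_prod big_map big_filter.
by apply: eq_bigr => z _; rewrite sqnormcN.
Qed.

Lemma sqmahler_ge_coef0 rs :
  sqnormc (\prod_(z <- rs) ('X - z%:P))`_0 <= sqmahler rs.
Proof.
rewrite -horner_coef0 horner_prod sqnormc_prod (bigID (fun z => 1 < sqnormc z)) /=.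
rewrite -[X in _ <= X]mulr1 ler_pM ?prodr_ge0 //.
- by move=> z _; apply: sqnormc_ge0.
- by move=> z _; apply: sqnormc_ge0.
- rewrite /sqmahler le_eqVlt; apply/orP; left; apply/eqP; apply: eq_bigr => z _.
  by rewrite !hornerE sqnormcN.
apply: prodr_ile1 => z zin.
by rewrite sqnormc_ge0 !hornerE sqnormcN leNgt.
Qed.

(* Reflecting the roots outside the unit circle preserves the 2-norm and makes
   the leading coefficient equal, in modulus, to the Mahler measure. *)
Lemma landau rs : rs != [::] -> 0 \notin rs ->
  sqmahler rs < \sum_(i < (size rs).+1) sqnormc (\prod_(z <- rs) ('X - z%:P))`_i.
Proof.
move=> rs0 nz; set P := \prod_(z <- rs) _.
pose u z : C := if 1 < sqnormc z then 1 else - z.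
pose v z : C := if 1 < sqnormc z then - z^*%C else 1.
pose G := \prod_(z <- rs) ((u z)%:P + v z *: 'X).
have GP : G * inner_den (outside rs) = P * inner_num (outside rs).
  rewrite inner_den_outside inner_num_outside /G /P.
  rewrite (bigID (fun z => 1 < sqnormc z)) /=.
  rewrite [in RHS](bigID (fun z => 1 < sqnormc z)) /=.
  have -> : \prod_(z <- rs | 1 < sqnormc z) ((u z)%:P + v z *: 'X) =
      \prod_(z <- rs | 1 < sqnormc z) (1 - z^*%C *: 'X).
    by apply: eq_bigr => z zo; rewrite /u /v zo scaleNr.
  have -> : \prod_(z <- rs | ~~ (1 < sqnormc z)) ((u z)%:P + v z *: 'X) =
      \prod_(z <- rs | ~~ (1 < sqnormc z)) ('X - z%:P).
    by apply: eq_bigr => z /negbTE zo; rewrite /u /v zo scale1r polyCN addrC.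
  by ring.
have GPN : eqmodXn (size rs).+1 (G * inner_den (outside rs))
    (P * inner_num (outside rs)) by rewrite GP.
have h := inner_contraction (@outside_data rs) GPN.
apply: lt_le_trans h.
rewrite big_ord_recr /= lead_prod_linear sqnormc_prod.
have -> : \prod_(z <- rs) sqnormc (v z) = sqmahler rs.
  rewrite /sqmahler [RHS]big_mkcond; apply: eq_bigr => z _; rewrite /v.
  by case: ifP => _; rewrite ?sqnormcN ?sqnormcJ ?sqnormc1.
(* Strictness comes from the constant coefficient of G: it is nonzero, and distinct from the leading
   one since G has positive degree. *)
have rs1 : (0 < size rs)%N by rewrite lt0n size_eq0.
rewrite ltrDr (bigD1 (Ordinal rs1)) //=.
rewrite ltr_pwDl ?sumr_ge0 // => [|i _]; last exact: sqnormc_ge0.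
rewrite coef0_prod_linear lt_def sqnormc_ge0 andbT sqnormc_eq0 prodf_seq_neq0.
apply/allP => z zrs /=; rewrite /u; case: ifP => _; rewrite ?oner_neq0 //.
by rewrite oppr_eq0; apply: contraNneq nz => <-.
Qed.

End Mahler.

(** * Smyth's theorem *)

Section Smyth.
Variable R : rcfType.
Local Notation C := R[i].
Implicit Types (f : {poly int}) (rs : seq C) (theta x : R).

Lemma plastic_lt2 theta : theta ^+ 3 = theta + 1 -> 1 < theta < 2.
Proof.
move=> h; rewrite !ltNge -negb_or; apply/negP => /orP[t1|t2]; last by nra.
have [t0|t0] := lerP 0 theta; first by nra.
by have [tm|tm] := lerP theta (-1); nra.
Qed.

(** For y = 1/x the hypothesis reads y^3 - y >= 1 = theta^3 - theta. If y < theta, factoring the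
    difference of the two sides by theta - y contradicts this. *)
Lemma plastic_le_inv theta x : theta ^+ 3 = theta + 1 -> 0 < x ->
  x ^+ 3 + x ^+ 2 <= 1 -> theta <= x^-1.
Proof.
move=> ht x0 hx; have /andP[t1 _] := plastic_lt2 ht.
have y0 : 0 < x^-1 by rewrite invr_gt0.
have yx : x^-1 * x = 1 by rewrite mulVf ?gt_eqF.
have hy : x^-1 + 1 <= (x^-1) ^+ 3.
  have := ler_wpM2l (ltW (exprn_gt0 3 y0)) hx.
  have -> : (x^-1) ^+ 3 * (x ^+ 3 + x ^+ 2) =
    (x^-1 * x) ^+ 3 + x^-1 * (x^-1 * x) ^+ 2 by ring.
  by rewrite yx !expr1n !mulr1 addrC.
move: hy y0; set y := x^-1; clear -ht t1 => hy y0.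
rewrite leNgt; apply/negP => yt.
have : 0 < (theta - y) * (theta ^+ 2 + theta * y + y ^+ 2 - 1).
  by apply: mulr_gt0; [rewrite subr_gt0 | nra].
have -> : (theta - y) * (theta ^+ 2 + theta * y + y ^+ 2 - 1) =
  theta ^+ 3 - theta - (y ^+ 3 - y) by ring.
by rewrite ht; move: hy; clear; lra.
Qed.

Lemma Re_intrM (c : int) (z : C) :
  complex.Re (c%:~R * z) = c%:~R * complex.Re z.
Proof.
rewrite -(rmorph_int (real_complex R)) [X in complex.Re X]mulrC [RHS]mulrC.
exact: Re_mul_real.
Qed.

Lemma map_intr_conj f :
  map_poly (@conjc R) (map_poly (intr : int -> C) f) = map_poly intr f.
Proof. by apply/polyP => i; rewrite !coef_map /= rmorph_int. Qed.

(** Integer coefficients make the roots stable under conjugation, so f* can be written with the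
    conjugate roots, as Blaschke factors require. *)
Lemma map_recip_prod f rs :
  map_poly (intr : int -> C) f = \prod_(z <- rs) ('X - z%:P) ->
  map_poly (intr : int -> C) (recip_poly f) = \prod_(z <- rs) (1 - z^*%C *: 'X).
Proof.
move=> frs; rewrite map_recip_poly; last exact: intr_inj.
rewrite -map_intr_conj frs rmorph_prod /=.
rewrite (eq_bigr (fun z => 'X - (z^*%C)%:P)) => [|z _]; last first.
  by rewrite rmorphB /= map_polyX map_polyC.
by have := recip_poly_prod_XsubC (map (@conjc R) rs); rewrite !big_map.
Qed.

Lemma smyth f rs theta : theta ^+ 3 = theta + 1 ->
  map_poly (intr : int -> C) f = \prod_(z <- rs) ('X - z%:P) ->
  f`_0 != 0 -> recip_poly f != f -> recip_poly f != - f ->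
  theta ^+ 2 <= sqmahler rs.
Proof.
move=> ht frs f0 fr fnr; have /andP[t1 t2] := plastic_lt2 ht.
have f0m : ((f`_0)%:~R : R) ^+ 2 <= sqmahler rs.
  have := sqmahler_ge_coef0 rs; rewrite -frs coef_map /=.
  by rewrite -(rmorph_int (real_complex R)) sqnormc_real.
(* M(f) is at least |f(0)|, so only f(0) = +-1 remains once theta < 2 is known. *)
have [f02|] := boolP (2 <= `|f`_0|).
  apply: le_trans f0m.
  have -> : ((f`_0)%:~R : R) ^+ 2 = (`|f`_0|%:~R) ^+ 2.
    by rewrite intr_norm real_normK ?num_real.
  apply: (@le_trans _ _ (2 ^+ 2)).
    by rewrite lerXn2r ?nnegrE ?ltW // (lt_trans ltr01).
  by rewrite lerXn2r ?nnegrE ?ler0n ?ler0z // (ler_int _ 2).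
rewrite -ltNge => f02; clear f0m.
have f01 : f`_0 * f`_0 = 1.
  have [->|->] : f`_0 = 1 \/ f`_0 = -1 by move: f0 f02; clear; lia.
    by [].
  by [].
have fmon : f \is monic.
  rewrite monicE -(inj_eq (intr_inj : injective (intr : int -> C))).
  rewrite -lead_coef_map_inj //; last exact: intr_inj.
  by rewrite frs -monicE monic_prod_XsubC.
pose fs := recip_poly f; pose N := (size f + size f)%N.
have sf : (0 < size f)%N by rewrite size_poly_gt0 monic_neq0.
have fs0 : fs`_0 = 1.
  by rewrite coef_poly sf subn0; apply/eqP; rewrite -lead_coefE.
(* The quotient f(0) f / f* has integer coefficients because f*(0) = 1. The precision N = 2 [size f]
   leaves room for 2k, since k < [size f]. *)
have [a afs] : exists a, eqmodXn N (a * fs) (f`_0 *: f).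
  by apply: eqmodXn_div; rewrite fs0.
have a0 : a`_0 = 1.
  have := afs 0%N; rewrite coef0M fs0 mulr1 [(_ *: f)`_0]coefZ f01; apply.
  by rewrite /N; lia.
have [k [k0 kN ak aik]] : exists k, [/\ (0 < k)%N, (k < size f)%N,
    a`_k != 0 & forall i, (0 < i < k)%N -> a`_i = 0].
  have [[k hk]|noa] := pselect (exists k, (0 < k < size f)%N && (a`_k != 0)).
    have ex : exists k, (0 < k < size f)%N && (a`_k != 0) by exists k.
    case: (ex_minnP ex) => l /andP[/andP[l0 ls] al] lmin; exists l; split=> //.
    move=> i il; apply/eqP; apply: contraT => ai.
    by have := lmin i; rewrite ai; lia.
  (* Were all these coefficients zero, f* would agree with f(0) f up to the degree, hence equal f or
     -f. *)
  suff fE : fs = f`_0 *: f.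
    have [e|e] : f`_0 = 1 \/ f`_0 = -1 by move: f0 f02; clear; lia.
      by rewrite -/fs fE e scale1r eqxx in fr.
    by rewrite -/fs fE e scaleN1r eqxx in fnr.
  apply/polyP => i; have [fi|fi] := ltnP i (size f); last first.
    rewrite coefZ [f`_i]nth_default // mulr0 nth_default //.
    exact: leq_trans (size_poly _ _) fi.
  have h1 : eqmodXn (size f) (a * fs) (1 * fs).
    apply: eqmodXnM => // j jf; rewrite coef1; case: j jf => // j jf.
    by apply/eqP; apply: contraT => aj; case: noa; exists j.+1; rewrite jf.
  rewrite -[fs]mul1r -h1 // afs // /N.
  by lia.
pose Li := inside rs; pose Lo := outside rs.
have LiD : inner_data Li := @inside_data _ rs.
have LoD : inner_data Lo := @outside_data _ rs.
have fLL : map_poly (intr : int -> C) f = inner_num Li * inner_den Lo.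
  rewrite frs inner_num_inside inner_den_outside mulrC.
  by rewrite (bigID (fun z => 1 < sqnormc z)).
have fsLL : map_poly (intr : int -> C) fs = inner_den Li * inner_num Lo.
  rewrite (map_recip_prod frs) inner_den_inside inner_num_outside mulrC.
  by rewrite (bigID (fun z => 1 < sqnormc z)).
have LiU := inner_den0 LiD; have LoU := inner_den0 LoD.
pose m := Num.sqrt (sqmahler rs); pose x := m^-1.
have m0 : 0 < m by rewrite sqrtr_gt0 (lt_le_trans ltr01) ?sqmahler_ge1.
have x0 : 0 < x by rewrite invr_gt0.
have m2 : m ^+ 2 = sqmahler rs.
  by rewrite sqr_sqrtr // (le_trans ler01) ?sqmahler_ge1.
(* A unimodular constant chosen to make D(0) equal to the positive real x = 1 / M(f). *)
pose kappa := (inner_den Lo)`_0 * x%:C%C.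
have kappa1 : sqnormc kappa = 1.
  rewrite sqnormcM sqnormc_den_outside0 sqnormc_real -m2 -exprMn.
  by rewrite mulfV ?expr1n ?gt_eqF.
pose eps := (f`_0)%:~R : C.
have eps1 : sqnormc (eps * kappa) = 1.
  rewrite sqnormcM kappa1 mulr1 /eps -(rmorph_int (real_complex R)) sqnormc_real.
  by rewrite expr2 -intrM f01.
have [Cp hCp] := eqmodXn_div N ((eps * kappa) *: inner_num Li) LiU.
have [Dp hDp] := eqmodXn_div N (kappa *: inner_num Lo) LoU.
pose aC := map_poly (intr : int -> C) a.
have aCfs : eqmodXn N (aC * (inner_den Li * inner_num Lo))
    (eps *: (inner_num Li * inner_den Lo)).
  move=> i iN; rewrite -fLL -fsLL -rmorphM /= coef_map afs //.
  by rewrite !coefZ coef_map /= rmorphM.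
have CaD : eqmodXn N Cp (aC * Dp).
  apply: (@eqmodXn_mulI _ _ (inner_den Li * inner_den Lo)).
    by rewrite coef0M unitrM LiU.
  have -> : inner_den Li * inner_den Lo * Cp = inner_den Lo * (Cp * inner_den Li).
    by ring.
  have -> : inner_den Li * inner_den Lo * (aC * Dp) =
      aC * inner_den Li * (Dp * inner_den Lo).
    by ring.
  apply: (@eqmodXn_trans _ _ _ (kappa *: (eps *: (inner_num Li * inner_den Lo)))).
    apply: (eqmodXn_trans (eqmodXnM (@eqmodXn_refl _ _ _) hCp)).
    by rewrite -scalerAr scalerA [kappa * _]mulrC [inner_den Lo * _]mulrC.
  apply: eqmodXn_sym.
  apply: (eqmodXn_trans (eqmodXnM (@eqmodXn_refl _ _ _) hDp)).
  move=> i iN; rewrite -scalerAr !coefZ; congr (_ * _).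
  by rewrite -mulrA aCfs // coefZ.
pose ReP := map_poly (@complex.Re R).
have ReC i : (ReP Cp)`_i = complex.Re Cp`_i by rewrite coef_map_id0.
have ReDp i : (ReP Dp)`_i = complex.Re Dp`_i by rewrite coef_map_id0.
have D0 : complex.Re Dp`_0 = x.
  have N0 : (0 < N)%N by rewrite addn_gt0 sf.
  have := hDp 0%N N0; rewrite coef0M coefZ.
  have -> : (inner_num Lo)`_0 = 1.
    rewrite /inner_num coef0_prod_linear big_map big_filter big1 // => z _.
    exact: conjc1.
  have d0 : (inner_den Lo)`_0 != 0 by rewrite -unitfE.
  by rewrite mulr1 /kappa mulrC => /(mulfI d0) ->.
have conv n : (n < N)%N ->
    (ReP Cp)`_n = \sum_(i < n.+1) (a`_i)%:~R * (ReP Dp)`_(n - i).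
  move=> nN; rewrite ReC CaD // coefM Re_sum; apply: eq_bigr => i _.
  by rewrite ReDp coef_map Re_intrM.
have C0 : (ReP Cp)`_0 = x.
  rewrite conv; last by rewrite /N; lia.
  by rewrite big_ord1 a0 mul1r ReDp D0.
have kkN : (k + k < N)%N by rewrite /N; lia.
have Cp0 : 0 < (ReP Cp)`_0 by rewrite C0.
have := smyth_extremal (a := fun i => a`_i) (hankel_bounded_inner LiD eps1 hCp)
  (hankel_bounded_inner LoD kappa1 hDp) k0 kkN Cp0 conv a0 aik ak.
rewrite -/ReP C0 => hx; have := plastic_le_inv ht x0 hx.
rewrite /x invrK -m2 => tm; rewrite lerXn2r ?nnegrE // ltW //.
exact: lt_trans t1.
Qed.

End Smyth.

(** * The orbit of 1 under the beta-transformation *)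

Section BetaOrbit.
Variables (R : realType) (beta : R).
Hypothesis beta1 : 1 < beta.

Local Notation t := (parry_digit beta).
Local Notation orb n := (iter n (beta_map beta) 1).

(** Bernoulli's inequality makes a nonzero e unbounded. It is applied to the orbit of 1 after its
    last nonzero digit, and to the difference of the orbit and its shift by a period. *)
Lemma bounded_geometric_eq0 (e : nat -> R) :
  (forall n, e n.+1 = beta * e n) -> (forall n, `|e n| <= 1) -> e 0%N = 0.
Proof.
move=> eS e1; apply/eqP; apply: contraT => e0.
have en n : `|e 0%N| * (1 + n%:R * (beta - 1)) <= `|e n|.
  elim: n => [|n IHn]; first by rewrite mul0r addr0 mulr1.
  rewrite eS normrM gtr0_norm ?(lt_trans ltr01) //.
  apply: le_trans (ler_wpM2l _ IHn); last by rewrite (le_trans ler01) ?ltW.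
  rewrite mulrCA ler_wpM2l // -natr1 -subr_ge0.
  have -> : beta * (1 + n%:R * (beta - 1)) - (1 + (n%:R + 1) * (beta - 1)) =
    n%:R * (beta - 1) ^+ 2 by ring.
  by rewrite mulr_ge0 ?sqr_ge0.
have d0 : 0 < `|e 0%N| * (beta - 1) by rewrite mulr_gt0 ?normr_gt0 ?subr_gt0.
pose x := (`|e 0%N| * (beta - 1))^-1.
have x0 : 0 <= x by rewrite invr_ge0 ltW.
have := archi_boundP x0; set n := Num.bound x => xn.
have : 1 < `|e 0%N| * (beta - 1) * n%:R.
  by rewrite mulrC -ltr_pdivrMr // div1r.
have := le_trans (en n) (e1 n); have := normr_ge0 (e 0%N).
move: (`|e 0%N|) => y; move: (n%:R) => k; clear; lra.
Qed.

Lemma beta_orbitS n : orb n.+1 = beta * orb n - (t n.+1)%:~R.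
Proof. by []. Qed.

Lemma beta_orbit_ge0_le1 n : 0 <= orb n <= 1.
Proof.
case: n => [|n]; first by rewrite ler01 lexx.
rewrite beta_orbitS /parry_digit /= subr_ge0 floor_le_tmp /=.
by rewrite lerBlDl; have := floorD1_gt (beta * orb n); rewrite intrD => /ltW.
Qed.

Lemma parry_digit_ge0 n : 0 <= t n.+1.
Proof.
rewrite floor_ge0 mulr_ge0 //; first by rewrite (le_trans ler01) ?ltW.
by case/andP: (beta_orbit_ge0_le1 n).
Qed.

(** The integer polynomial in beta that computes the n-th iterate of 1; every Parry polynomial is
    one of these or a difference of two. *)
Definition orbit_poly n : {poly int} :=
  'X^n - \sum_(1 <= i < n.+1) t i *: 'X^(n - i).

Lemma orbit_poly0 : orbit_poly 0 = 1.
Proof. by rewrite /orbit_poly big_geq // subr0 expr0. Qed.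

Lemma orbit_polyS n : orbit_poly n.+1 = orbit_poly n * 'X - (t n.+1)%:P.
Proof.
rewrite /orbit_poly big_nat_recr //= subnn expr0 alg_polyC opprD addrA.
congr (_ - _); rewrite mulrBl -exprSr; congr (_ - _); rewrite big_distrl /=.
apply: eq_big_nat => i /andP[_ ile].
by rewrite -scalerAl -exprSr subSn // -ltnS.
Qed.

Lemma horner_orbit_poly n : (map_poly intr (orbit_poly n)).[beta] = orb n.
Proof.
elim: n => [|n IHn]; first by rewrite orbit_poly0 rmorph1 hornerC.
rewrite orbit_polyS rmorphB rmorphM /= map_polyX map_polyC /= !hornerE IHn.
by rewrite mulrC.
Qed.

Lemma coef0_orbit_poly n : (orbit_poly n.+1)`_0 = - t n.+1.
Proof. by rewrite orbit_polyS coefB coefMX coefC sub0r. Qed.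

Lemma orbit_end m : digits_end_at beta m -> orb m = 0.
Proof.
move=> [_ _ tm]; pose e k := orb (m + k).
have -> : orb m = e 0%N by rewrite /e addn0.
apply: bounded_geometric_eq0 => k.
  by rewrite /e addnS beta_orbitS tm ?subr0 //; lia.
by rewrite ger0_norm; case/andP: (beta_orbit_ge0_le1 (m + k)).
Qed.

Lemma orbit_periodic m p : digits_periodic_from beta m p ->
  orb (m + p.+1) = orb m.
Proof.
move=> per; apply/eqP; rewrite -subr_eq0; apply/eqP.
pose e k := orb (m + p.+1 + k) - orb (m + k).
have -> : orb (m + p.+1) - orb m = e 0%N by rewrite /e !addn0.
apply: bounded_geometric_eq0 => k.
  rewrite /e !addnS !beta_orbitS.
  have -> : t (m + p + k).+2 = t (m + k).+1.
    by rewrite -(per (m + k).+1); [congr t; lia | lia].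
  rewrite -beta_orbitS -!addSn; ring.
rewrite /e; have := beta_orbit_ge0_le1 (m + p.+1 + k).
have := beta_orbit_ge0_le1 (m + k); move: (orb _) (orb _) => u v.
by move=> /andP[? ?] /andP[? ?]; rewrite ler_norml; apply/andP; split; lra.
Qed.

Lemma parry_polyE P : is_parry_poly beta P ->
  (exists2 m, digits_end_at beta m & P = orbit_poly m) \/
  (exists m p, minimal_preperiod_period beta m p /\
     P = orbit_poly (m + p.+1) - orbit_poly m).
Proof.
move=> [m mE|m p _ mp _|p _ mp]; first by left; exists m.
  right; exists m, p; split=> //.
  by rewrite [X in _ = _ - X]/orbit_poly opprB addrA [RHS]addrAC.
right; exists 0%N, p; split=> //.
rewrite add0n orbit_poly0 /orbit_poly [in RHS]big_nat_recr //= subnn.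
by rewrite [_ *: 'X^0]alg_polyC polyCD polyC1; ring.
Qed.

Lemma parry_poly_root P : is_parry_poly beta P -> root (map_poly intr P) beta.
Proof.
move=> /parry_polyE[[m mE ->]|[m [p [[per _ _] ->]]]]; rewrite rootE.
  by rewrite horner_orbit_poly orbit_end.
by rewrite rmorphB hornerD hornerN !horner_orbit_poly orbit_periodic ?subrr.
Qed.

(** Up to sign the constant term is t_m, or 1 + t_(p+1) with t_(p+1) >= 0, or t_(m+p+1) - t_m. If
    the last vanished, the preperiod could be shortened by one. *)
Lemma parry_poly_coef0 P : is_parry_poly beta P -> P`_0 != 0.
Proof.
move=> /parry_polyE[[[|m] [// _ tm _] ->]|[[|m] [p [[per mmin _] ->]]]].
- by rewrite coef0_orbit_poly oppr_eq0.
- rewrite add0n coefB coef0_orbit_poly orbit_poly0 coef1 /=.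
  by have := parry_digit_ge0 p; lia.
rewrite addSn coefB !coef0_orbit_poly opprK addrC subr_eq0.
apply/eqP => tE; have := mmin m p; rewrite ltnn => H.
suff : false by []; apply: H => i; rewrite leq_eqVlt => /orP[/eqP <-|/per //].
by rewrite addSn.
Qed.

End BetaOrbit.

(** * Irreducible factors *)

Lemma Cyclotomic1 : 'Phi_1 = 'X - 1.
Proof. by have := prod_Cyclotomic (ltn0Sn 0); rewrite big_seq1. Qed.

Lemma root_Cyclotomic_expr (F : idomainType) (n : nat) (x : F) : (0 < n)%N ->
  root (map_poly intr 'Phi_n) x -> x ^+ n = 1.
Proof.
move=> n0 rx; have := prod_Cyclotomic n0.
rewrite (big_rem n) /=; last by rewrite -dvdn_divisors.
move=> /(congr1 (fun p => (map_poly (intr : int -> F) p).[x])).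
rewrite rmorphM hornerM (eqP rx) mul0r rmorphB rmorph1 /= map_polyXn.
by rewrite !hornerE => /esym/eqP; rewrite subr_eq0 => /eqP.
Qed.

Lemma monic_mul_unit (p q r : {poly int}) : p \is monic -> q \is monic ->
  p = q * r -> r \is a GRing.unit -> p = q.
Proof.
move=> pm qm pE; rewrite poly_unitE => /andP[/eqP r1 _].
have rC := size1_polyC (eq_leq r1).
have : lead_coef r = 1.
  by have := lead_coefM q r; rewrite -pE (monicP pm) (monicP qm) mul1r => <-.
by rewrite lead_coefE r1 /= pE rC coefC /= => ->; rewrite mulr1.
Qed.

(** If f* = -f, then f(1) = f*(1) = -f(1), so X - 1 divides f and f is the first cyclotomic
    polynomial. *)
Lemma irreducible_recip_neqN (f : {poly int}) : f \is monic ->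
  irreducible_elt f -> ~ cyclotomic_poly f -> recip_poly f != - f.
Proof.
move=> fm [_ _ irr] ncyc; apply/eqP => fE; apply: ncyc; exists 1%N => //.
have : root f 1.
  rewrite rootE; have := recip_poly_horner1 f; rewrite fE hornerN.
  by move: (f.[1]) => y; lia.
rewrite Cyclotomic1 => /factor_theorem[q]; rewrite mulrC => fq.
have [] := irr _ _ fq; last exact: monic_mul_unit (monicXsubC 1) fq.
by rewrite poly_unitE size_XsubC.
Qed.

Section RootMultiset.
Variable R : rcfType.
Local Notation C := R[i].

Definition int_roots (f : {poly int}) : seq C :=
  sval (closed_field_poly_normal (map_poly (intr : int -> C) f)).

Lemma int_rootsP f : f \is monic ->
  map_poly (intr : int -> C) f = \prod_(z <- int_roots f) ('X - z%:P).
Proof.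
move=> fm; rewrite /int_roots; case: closed_field_poly_normal => r /= {1}->.
by rewrite (monicP (monic_map _ fm)) scale1r.
Qed.

Lemma sqmahler_flatten (s : seq {poly int}) :
  sqmahler (flatten (map int_roots s)) = \prod_(f <- s) sqmahler (int_roots f).
Proof. by rewrite /sqmahler big_flatten /= big_map. Qed.

Lemma count_bound_sqmahler (s : seq {poly int}) (a : pred {poly int}) (c : R) :
  0 <= c -> (forall f, f \in s -> a f -> c <= sqmahler (int_roots f)) ->
  c ^+ count a s <= sqmahler (flatten (map int_roots s)).
Proof.
move=> c0; rewrite sqmahler_flatten; elim: s => [|f s IHs] hs.
  by rewrite big_nil.
rewrite big_cons exprD ler_pM ?exprn_ge0 //.
  case af: (a f); last exact: sqmahler_ge1.
  by rewrite expr1 hs ?mem_head.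
by apply: IHs => g gs; apply: hs; rewrite inE gs orbT.
Qed.

End RootMultiset.

Lemma minimal_poly_dvd (R : realType) (x : R) (P Q : {poly rat}) :
  is_minimal_poly x P -> root (map_poly ratr Q) x -> P %| Q.
Proof.
move=> [Pm Px Pmin] Qx; rewrite /dvdp; apply: contraT => r0.
suff : root (map_poly ratr (Q %% P)) x.
  by move/(Pmin _ r0); rewrite leqNgt ltn_modp monic_neq0.
have := congr1 (fun p => (map_poly ratr p).[x]) (divp_eq Q P).
rewrite rmorphD rmorphM hornerD hornerM (eqP Qx) (eqP Px) mulr0 add0r.
by rewrite rootE => <-.
Qed.

(** Gauss's lemma, through [dvdpP_rat_int], turns divisibility by P over the rationals into a
    factorisation of f over the integers. Irreducibility makes one factor a unit, and it cannot be
    the one proportional to P, which has a root. *)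
Lemma minimal_poly_irreducible_factor (R : realType) (x : R) (P : {poly rat})
    (f : {poly int}) : is_minimal_poly x P -> f \is monic ->
  irreducible_elt f -> root (map_poly intr f) x -> map_poly intr f = P.
Proof.
move=> Pmin fm [_ _ irr] fx.
have : P %| map_poly intr f.
  apply: (minimal_poly_dvd Pmin); rewrite -map_poly_comp /=.
  by rewrite (eq_map_poly (fun z => ratr_int R z)).
move=> /dvdpP_rat_int[p [a a0 PE] [r fE]].
have [Pm Px _] := Pmin.
have [|rU] := irr _ _ fE.
  rewrite poly_unitE => /andP[/eqP p1 _]; exfalso.
  have : (size P <= 1)%N.
    by rewrite PE size_scale // size_map_inj_poly ?p1 //; apply: intr_inj.
  move=> /size1_polyC PC; have : P != 0 by apply: monic_neq0.
  rewrite PC polyC_eq0 => c0; move: Px.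
  by rewrite PC map_polyC rootC fmorph_eq0 (negbTE c0).
move: rU; rewrite poly_unitE => /andP[/eqP r1 _].
have rC := size1_polyC (eq_leq r1); set c := r`_0 in rC.
have fP : map_poly intr f = (c%:~R / a) *: P.
  rewrite PE scalerA divfK // fE rC rmorphM /= map_polyC /=.
  by rewrite mulrC mul_polyC.
have : lead_coef (map_poly (intr : int -> rat) f) = 1.
  exact/monicP/monic_map.
by rewrite fP lead_coefZ (monicP Pm) mulr1 => ->; rewrite scale1r.
Qed.

Theorem theorem3p9 (R : realType) (beta theta0 : R) (P : {poly int})
    (s : seq {poly int})
    (hbeta : parry_number beta)
    (hP : is_parry_poly beta P)
    (htheta0 : is_dominant_root ('X^3 - 'X - 1) theta0)
    (hs : irreducible_factorization P s) :
  (count noncyclo_nonrecip s)%:R < ln (poly_norm2 R P) / ln theta0 /\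
  (forall Pbeta : {poly rat},
     is_minimal_poly beta Pbeta -> ~ reciprocal_poly Pbeta ->
     exists2 f : {poly int}, f \in filter noncyclo_nonrecip s
       & map_poly intr f = Pbeta).
Proof.
have [beta1 _ _] := hbeta; have [sirr PE] := hs.
have Pm : P \is monic.
  rewrite PE big_seq; elim/big_ind: _ => [|p q pm qm|f /sirr[]//].
    exact: monic1.
  by rewrite monicMl.
have P0 := parry_poly_coef0 beta1 hP; have Px := parry_poly_root beta1 hP.
split; last first.
  move=> Q Qmin Qnr.
  have [f fs fx] : exists2 f, f \in s & root (map_poly intr f) beta.
    move: Px; rewrite PE rmorph_prod /= rootE horner_prod prodf_seq_eq0.
    by case/hasP => f fs fx; exists f.
  have [fm firr] := sirr f fs.
  have fQ := minimal_poly_irreducible_factor Qmin fm firr fx.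
  exists f => //; rewrite mem_filter fs andbT; apply/asboolP; split.
    (* A cyclotomic factor would make beta > 1 a root of unity. *)
    move=> [n n0 fE]; rewrite fE in fx; have := root_Cyclotomic_expr n0 fx.
    by move/eqP; rewrite gt_eqF // exprn_egt1 // -lt0n.
  move=> frec; apply: Qnr; rewrite /reciprocal_poly -fQ -map_recip_poly -?frec //.
  exact: intr_inj.
have ht : theta0 ^+ 3 = theta0 + 1.
  have [] := htheta0; rewrite rootE !hornerE => /eqP h _; lra.
have /andP[t1 _] := plastic_lt2 ht.
have t0 : 0 < theta0 := lt_trans ltr01 t1.
pose rs := flatten (map (@int_roots R) s).
have Prs : map_poly (intr : int -> R[i]) P = \prod_(z <- rs) ('X - z%:P).
  rewrite PE rmorph_prod big_flatten /= big_map; apply: eq_big_seq => f fs.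
  by rewrite int_rootsP //; case: (sirr f fs).
have low : (theta0 ^+ 2) ^+ count noncyclo_nonrecip s <= sqmahler rs.
  apply: count_bound_sqmahler => [|f fs /asboolP[ncyc nrec]]; first exact: sqr_ge0.
  have [fm firr] := sirr f fs.
  apply: (smyth ht (int_rootsP R fm)).
  - apply: contraNneq P0 => f0; rewrite PE (big_rem f) //=.
    by rewrite coef0M f0 mul0r.
  - by apply/eqP => e; apply: nrec.
  - exact: irreducible_recip_neqN.
have szP : size P = (size rs).+1.
  by rewrite -(size_map_inj_poly (intr_inj : injective (intr : int -> R[i]))) ?Prs
    ?size_prod_XsubC.
have rs0 : rs != [::].
  apply/eqP => rs0; have := Prs; rewrite rs0 big_nil => P1.
  have : P = 1.
    by apply: (map_inj_poly (intr_inj : injective (intr : int -> R[i])));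
      rewrite ?rmorph1.
  by move=> PE1; move: Px; rewrite PE1 rmorph1 rootE hornerC oner_eq0.
have nz : 0 \notin rs.
  apply: contra P0 => z0.
  rewrite -(inj_eq (intr_inj : injective (intr : int -> R[i]))) -coef_map /=.
  by rewrite Prs -horner_coef0 horner_prod (big_rem _ z0) /= !hornerE oppr0 mul0r.
(* With c the count, theta0^(2c) <= M(P)^2 < ||P||_2^2; square roots and logarithms then give the
   bound. *)
have := le_lt_trans low (landau rs0 nz); rewrite -Prs -szP.
have -> : \sum_(i < size P) sqnormc (map_poly (intr : int -> R[i]) P)`_i =
    poly_norm2 R P ^+ 2.
  rewrite sqr_sqrtr ?sumr_ge0 // => [|i _]; last by rewrite exprn_ge0.
  apply: eq_bigr => i _; rewrite coef_map /= real_normK ?num_real //.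
  by rewrite -(rmorph_int (real_complex R)) sqnormc_real.
have n0 : 0 <= poly_norm2 R P by apply: sqrtr_ge0.
rewrite exprAC -subr_gt0 subr_sqr pmulr_lgt0; last first.
  by rewrite ltr_wpDl // exprn_gt0.
rewrite subr_gt0 => lt1.
rewrite ltr_pdivlMr ?ln_gt0 // mulr_natl -lnXn // ltr_ln // posrE.
  by rewrite exprn_gt0.
exact: lt_trans (exprn_gt0 _ t0) lt1.
Qed.
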